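(* Every finite simple graph $G$ with tree-width $\mathrm{tw}(G)\geq 1$ and maximum degree $\Delta(G)\geq 1$ has tree-partition-width $$\mathrm{tpw}(G)<\tfrac{5}{2}\big(\mathrm{tw}(G)+1\big)\big(\tfrac{7}{2}\,\Delta(G)-1\big).$$
   Context: All graphs are finite, simple and undirected. A graph $H$ is a partition of a graph $G$ if each vertex of $H$ (called a bag) is a set of vertices of $G$, every vertex of $G$ lies in exactly one bag, and distinct bags $A,B$ are adjacent in $H$ if and only if some edge of $G$ has one endpoint in $A$ and the other in $B$. The width of a partition is the maximum number of vertices of $G$ in a bag. If a forest $T$ is a partition of $G$, then $T$ is a tree-partition of $G$. The tree-partition-width $\mathrm{tpw}(G)$ is the minimum width of a tree-partition of $G$. $\mathrm{tw}(G)$ denotes the tree-width of $G$ and $\Delta(G)$ its maximum degree. *)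

(* Defs.v *)
(* boolp serves only to take minima of sets of naturals given by arbitrary
   propositions. *)
From mathcomp Require Import all_boot all_order all_algebra.
From mathcomp Require Import boolp.

Set Implicit Arguments.
Unset Strict Implicit.
Unset Printing Implicit Defensive.

Record sgraph := SGraph {
  vertex :> finType;
  adj : rel vertex;
  adj_sym : symmetric adj;
  adj_irr : irreflexive adj }.

Definition degree (G : sgraph) (v : G) : nat := #|[set w | adj v w]|.

Definition max_degree (G : sgraph) : nat := \max_(v : G) degree v.

(* A duplicate-free closed walk of length 2 merely traverses one edge back and
   forth, so only lengths at least 3 are genuine cycles. *)
Definition forest (G : sgraph) : Prop :=
  forall c : seq G, ucycle (@adj G) c -> size c <= 2.

Definition connected (G : sgraph) : Prop :=
  0 < #|G| /\ forall x y : G, connect (@adj G) x y.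

Definition tree (G : sgraph) : Prop := connected G /\ forest G.

Definition induced_adj (G : sgraph) (A : {set G}) : rel {x : G | x \in A} :=
  fun x y => adj (val x) (val y).

Lemma induced_sym (G : sgraph) (A : {set G}) : symmetric (@induced_adj G A).
Proof. by move=> x y; apply: adj_sym. Qed.

Lemma induced_irr (G : sgraph) (A : {set G}) : irreflexive (@induced_adj G A).
Proof. by move=> x; apply: adj_irr. Qed.

Definition induced (G : sgraph) (A : {set G}) : sgraph :=
  SGraph (@induced_sym G A) (@induced_irr G A).

Definition min_nat (P : nat -> Prop) (exP : exists n, P n) : nat :=
  @ex_minn (fun n => `[< P n >])
    (let: ex_intro n Pn := exP in ex_intro _ n (asboolT Pn)).

Lemma min_natP (P : nat -> Prop) (exP : exists n, P n) :
  P (min_nat exP) /\ forall n, P n -> min_nat exP <= n.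
Proof.
rewrite /min_nat; case: ex_minnP => m /asboolP Pm minm; split=> // n Pn.
exact/minm/asboolP.
Qed.

Definition tree_decomposition (G T : sgraph) (bag : T -> {set G}) : Prop :=
  [/\ tree T,
      forall v w : G, adj v w -> exists t : T, v \in bag t /\ w \in bag t &
      forall v : G, connected (induced [set t : T | v \in bag t])].

(* The predecessor is truncated, so the graph without vertices gets tree-width
   0 instead of -1; all other graphs are unaffected. *)
Definition decomposition_width (G T : sgraph) (bag : T -> {set G}) : nat :=
  (\max_(t : T) #|bag t|).-1.

Definition has_tree_decomposition (G : sgraph) (k : nat) : Prop :=
  exists (T : sgraph) (bag : T -> {set G}),
    tree_decomposition bag /\ decomposition_width bag = k.

Lemma unit_irr : irreflexive (fun _ _ : unit => false).
Proof. by []. Qed.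

Definition point_graph : sgraph :=
  @SGraph unit (fun _ _ => false) (fun _ _ => erefl) unit_irr.

Lemma forest_le1 (G : sgraph) : #|G| <= 1 -> forest G.
Proof.
move=> G1 c /andP[_ /card_uniqP <-].
exact: leq_trans (max_card _) (leqW G1).
Qed.

Lemma ex_tree_decomposition (G : sgraph) :
  exists k, has_tree_decomposition G k.
Proof.
eexists; exists point_graph, (fun=> setT); split; last by [].
have tt_in (v : G) : tt \in [set t : point_graph | v \in [set: G]].
  by rewrite !inE.
split=> [|v w _|v].
- split; last by apply: forest_le1; rewrite card_unit.
  by split=> [|[] []]; [rewrite card_unit | exact: connect0].
- by exists tt; rewrite !inE.
- split=> [|[[] tx] [[] ty]]; first by apply/card_gt0P; exists (Sub tt (tt_in v)).
  by rewrite (bool_irrelevance tx ty) connect0.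
Qed.

Definition tw (G : sgraph) : nat := min_nat (ex_tree_decomposition G).

(* The bags of a partition form the set P of vertex sets; its graph structure
   is then forced. As with any set of sets, P may contain the empty set, which
   is an isolated vertex of the quotient. *)
Definition partition_bags (G : sgraph) (P : {set {set G}}) : Prop :=
  forall v : G, exists! B : {set G}, B \in P /\ v \in B.

Definition quotient_adj (G : sgraph) (P : {set {set G}}) :
    rel {B : {set G} | B \in P} :=
  fun A B => (A != B) &&
    [exists a in val A, exists b in val B, adj a b].

Lemma quotient_sym (G : sgraph) (P : {set {set G}}) :
  symmetric (@quotient_adj G P).
Proof.
suff sub A B : @quotient_adj G P A B -> @quotient_adj G P B A.
  by move=> A B; apply/idP/idP; apply: sub.
case/andP=> neqAB /exists_inP[a Aa /exists_inP[b Bb ab]].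
rewrite /quotient_adj eq_sym neqAB; apply/exists_inP; exists b => //.
by apply/exists_inP; exists a; rewrite // adj_sym.
Qed.

Lemma quotient_irr (G : sgraph) (P : {set {set G}}) :
  irreflexive (@quotient_adj G P).
Proof. by move=> A; rewrite /quotient_adj eqxx. Qed.

Definition quotient (G : sgraph) (P : {set {set G}}) : sgraph :=
  SGraph (@quotient_sym G P) (@quotient_irr G P).

Definition tree_partition (G : sgraph) (P : {set {set G}}) : Prop :=
  partition_bags P /\ forest (quotient P).

Definition partition_width (G : sgraph) (P : {set {set G}}) : nat :=
  \max_(B in P) #|B|.

Definition has_tree_partition (G : sgraph) (k : nat) : Prop :=
  exists P : {set {set G}}, tree_partition P /\ partition_width P = k.

Lemma ex_tree_partition (G : sgraph) : exists k, has_tree_partition G k.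
Proof.
eexists; exists [set setT]; split; last by [].
split=> [v|].
  by exists setT; split=> [|B [/set1P-> _]]; rewrite ?inE.
apply: forest_le1; rewrite card_sig -(cards1 [set: G]).
by apply: subset_leq_card; apply/subsetP.
Qed.

Definition tpw (G : sgraph) : nat := min_nat (ex_tree_partition G).

(* Main.v *)
(* Let k = tw(G) + 1, let D be the maximum degree and let S be a set of at most
   4kD vertices. In a rooted tree-decomposition of width k - 1, scan the nodes
   from the leaves up and mark a node when the part of the tree hanging below it
   would otherwise carry more than 2k vertices of S or touch two marked nodes
   below. Each component of unmarked nodes then meets at most two marked nodes
   (the one above it and at most one below), and the number m of marked nodes,
   if positive, satisfies k(m + 1) < |S|. Adding the marked bags to S therefore
   gives a set X with |X| < 2|S| - k, and every component of G - X has at most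
   2k + k + k = 4k neighbours in X. Make X a bag and recurse into each component
   C with S replaced by the neighbours of X in C, of which there are at most 4kD.
   The resulting width is less than 8kD - k, which is enough when D >= 2; for
   D = 1 the singletons form a tree-partition. *)
Require Import Defs.
From mathcomp Require Import all_boot all_order all_algebra.
From mathcomp Require Import boolp zify lra.

Set Implicit Arguments.
Unset Strict Implicit.
Unset Printing Implicit Defensive.

Import GRing.Theory Num.Theory.

(** * Rooted trees and rooted tree-decompositions *)

(** On a cycle of length at least 3, take a vertex whose label has the largest [d]: both its
    neighbours on the cycle are labelled by its parent, so they coincide by injectivity. *)
Lemma forest_of_parent (H : sgraph) (L : Type) (lab : H -> L) (p : L -> L)
    (d : L -> nat) :
  injective lab ->
  (forall x y, adj x y -> (p (lab x) = lab y /\ d (lab y) < d (lab x)) \/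
                          (p (lab y) = lab x /\ d (lab x) < d (lab y))) ->
  forest H.
Proof.
move=> lab_inj adjP c /andP[cyc_c uniq_c]; rewrite leqNgt; apply/negP => c_gt2.
have [x0 x0c] : exists x, x \in c.
  by case: c c_gt2 {cyc_c uniq_c} => // x c _; exists x; rewrite mem_head.
case: (arg_maxnP (fun x => d (lab x)) x0c) => x xc max_x.
have [i c' def_c] := rot_to xc.
have max_up y : adj x y -> y \in c -> p (lab x) = lab y.
  by move=> /adjP[[]|[_ lt_xy]] // /max_x; rewrite /= leqNgt lt_xy.
have mem_c y : (y \in c) = (y \in x :: c') by rewrite -def_c mem_rot.
move: cyc_c uniq_c c_gt2; rewrite -(rot_cycle i) -(rot_uniq i) -(size_rot i) def_c.
case: c' mem_c {def_c} => [|y [|z c']] mem_c //=.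
rewrite rcons_path => /and3P[xy _ /andP[_ lx]] /and4P[_ yN _ _] _.
have /lab_inj eq_y : lab y = lab (last z c').
  rewrite -(max_up y) ?mem_c ?inE ?eqxx ?orbT //; apply: max_up.
    by rewrite adj_sym.
  by rewrite mem_c 2!in_cons mem_last !orbT.
by rewrite eq_y mem_last in yN.
Qed.

(** A connected set [D] grows from a root, one vertex [t] at a time. The only neighbour of [t] in
    [D] becomes its parent: with a second one, a path inside [D] would close to a cycle through [t].
    The root is a fixed point of [par]. *)
Lemma tree_rooted (T : sgraph) :
  tree T -> exists (par : T -> T) (rk : T -> nat),
    (forall t, par t != t -> rk (par t) < rk t) /\
    (forall s t, adj s t -> par s = t \/ par t = s).
Proof.
case=> [[T_gt0 connT] acycT].
pose E (D : {set T}) := [rel u v | [&& adj u v, u \in D & v \in D]].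
have grow n : 0 < n <= #|T| -> exists (D : {set T}) (par : T -> T) (rk : T -> nat),
    [/\ #|D| = n, {in D &, forall x y, connect (E D) x y},
        {in D, forall t, [/\ par t \in D, rk t < n & par t != t -> rk (par t) < rk t]} &
        {in D &, forall s t, adj s t -> par s = t \/ par t = s}].
  elim: n => // -[_ _|n IHn le_nT].
    have /card_gt0P[r _] := T_gt0.
    exists [set r], id, (fun=> 0); split; rewrite ?cards1 //.
    - by move=> x y /set1P-> /set1P->; apply: connect0.
    - by move=> t tr; rewrite eqxx.
    - by move=> s t /set1P-> /set1P->; rewrite adj_irr.
  have [|D [par [rk [cardD connD rkD adjD]]]] := IHn; first by apply: ltnW.
  have [x [t [xD tD xt]]] : exists x t, [/\ x \in D, t \notin D & adj x t].
    apply: contrapT => noedge.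
    have clD : closed (@adj T) (mem D).
      have clD1 u v : adj u v -> u \in D -> v \in D.
        move=> uv uD; apply: contraPT isT => vD _; apply: noedge.
        by exists u, v.
      by move=> u v uv; apply/idP/idP; apply: clD1; rewrite // adj_sym.
    have /card_gt0P[x xD] : 0 < #|D| by rewrite cardD.
    suff /subset_leq_card : [set: T] \subset D by rewrite cardsT cardD; lia.
    apply/subsetP => y _.
    by have := closed_connect clD (connT x y); rewrite xD => <-.
  have uniq_x y : y \in D -> adj y t -> y = x.
    move=> yD yt; apply/eqP; apply: contraT => neq_yx.
    have /connectP[p pth_p last_p] := connD _ _ xD yD.
    case/shortenP: pth_p last_p => p' pth_p' uniq_p' _ last_p'.
    have pD : all (mem D) (x :: p').
      elim: p' x xD pth_p' {last_p' neq_yx uniq_p' xt} => [|z p' IHp] x xD /=.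
        by rewrite xD.
      by case/andP=> /and3P[_ _ zD] /(IHp _ zD) /= ->; rewrite xD.
    have /acycT /= : ucycle (@adj T) (t :: x :: p').
      rewrite /ucycle /= rcons_path -last_p' yt andbT adj_sym xt /=.
      rewrite (@sub_path _ (E D)) //=; last by move=> u v /and3P[].
      rewrite /= in uniq_p'; rewrite uniq_p' andbT.
      by apply: contra tD => /(allP pD).
    by case: p' last_p' {pth_p' uniq_p' pD} => //= y_x; rewrite y_x eqxx in neq_yx.
  have neq_t u : u \in D -> (u == t) = false.
    by move=> uD; apply: contraNF tD => /eqP <-.
  have subE : subrel (connect (E D)) (connect (E (t |: D))).
    apply: connect_sub => u v /and3P[uv uD vD]; apply: connect1.
    by rewrite /E /= uv !inE uD vD !orbT.
  exists (t |: D), (fun u => if u == t then x else par u),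
    (fun u => if u == t then n.+1 else rk u); split.
  - by rewrite cardsU1 tD cardD.
  - have txc : connect (E (t |: D)) t x.
      by apply: connect1; rewrite /E /= adj_sym xt !inE eqxx xD orbT.
    have xtc : connect (E (t |: D)) x t.
      by apply: connect1; rewrite /E /= xt !inE eqxx xD orbT.
    move=> u v /setU1P[->|uD] /setU1P[->|vD] //.
    + by apply: connect_trans txc _; apply: subE; apply: connD.
    + by apply: connect_trans xtc; apply: subE; apply: connD.
    + by apply: subE; apply: connD.
  - move=> u /setU1P[->|uD].
      rewrite eqxx inE xD orbT neq_t //; have [_ lt_x _] := rkD _ xD.
      by split=> [||_] //; lia.
    rewrite neq_t //; have [parD lt_u par_u] := rkD _ uD.
    by rewrite neq_t // inE parD orbT; split; last exact: par_u; lia.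
  - move=> u v /setU1P[->|uD] /setU1P[->|vD]; first by rewrite adj_irr.
    + by rewrite adj_sym eqxx neq_t // => /uniq_x ->; [left|].
    + by rewrite eqxx neq_t // => /uniq_x ->; [right|].
    + by rewrite !neq_t //; apply: adjD.
have [|D [par [rk [cardD _ rkD adjD]]]] := grow #|T|; first by rewrite T_gt0 leqnn.
have inD t : t \in D.
  have /eqP -> : D == setT by rewrite eqEcard subsetT cardsT cardD leqnn.
  by rewrite inE.
by exists par, rk; split=> [t|s t]; [have [] := rkD t (inD t) | apply: adjD].
Qed.

(** [top v] is a node of least rank among those holding [v]. If the step up from another such node
    [s] failed, the nodes holding [v] below [s] would be closed under adjacency; by connectedness
    [s] would be a proper ancestor of [top v], hence of smaller rank. *)
Lemma tree_decomposition_rooted (G T : sgraph) (bag : T -> {set G}) :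
  tree_decomposition bag -> exists (par : T -> T) (rk : T -> nat) (top : G -> T),
    [/\ forall t, par t != t -> rk (par t) < rk t,
        forall v, v \in bag (top v) &
        forall v t, v \in bag t -> t != top v ->
          par t != t /\ v \in bag (par t)].
Proof.
case=> treeT _ conn_bag.
have [par [rk [par_lt adjP]]] := tree_rooted treeT.
have /choice[top topP] v : exists t, v \in bag t /\
    forall s, v \in bag s -> s != t -> par s != s /\ v \in bag (par s).
  have [] := conn_bag v; rewrite card_sig => /card_gt0P[t0].
  rewrite !inE => vt0 conn_v.
  case: (@arg_minnP _ t0 (fun t => v \in bag t) rk vt0) => t vt min_t.
  exists t; split=> // s vs neq_st.
  apply/andP; apply: contraT; rewrite negb_and negbK => stuck.
  have vt' : t \in [set t : T | v \in bag t] by rewrite inE.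
  have vs' : s \in [set t : T | v \in bag t] by rewrite inE.
  have cl : closed (@induced_adj T [set t : T | v \in bag t])
                   (fun u => fconnect par (val u) s).
    have cl1 (x y : induced [set t : T | v \in bag t]) :
        adj x y -> fconnect par (val x) s -> fconnect par (val y) s.
      move=> /adjP[xy|yx] xs; last first.
        by apply: connect_trans xs; rewrite -yx fconnect1.
      move: (valP y); rewrite inE -xy => vy.
      case/iter_findex: xs => xs; case: (findex par (val x) s) xs => [|n] /= xs.
        by case/orP: stuck => [/eqP|]; rewrite -xs ?vy // => ->.
      by rewrite -xs -iterS iterSr fconnect_iter.
    by move=> x y xy; apply/idP/idP; apply: cl1; rewrite // adj_sym.
  have := closed_connect cl (conn_v (Sub s vs') (Sub t vt')).
  rewrite /= -!topredE /= connect0 => ts.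
  have : s = t \/ rk s < rk t.
    move/esym/iter_findex: ts => <-; elim: (findex _ _ _) => [|n [IH|IH]] /=; first by left.
      by rewrite IH; case: (eqVneq (par t) t) => [->|/par_lt]; [left|right].
    case: (eqVneq (par (iter n par t)) (iter n par t)) => [->|/par_lt]; first by right.
    by right; lia.
  case=> [/eqP|]; first by rewrite (negPf neq_st).
  by rewrite ltnNge min_t.
exists par, rk, top; split=> // [v|v t vt neq_t]; first by case: (topP v).
by case: (topP v) => _; apply.
Qed.

(** * Marking nodes in a rooted forest *)

Lemma sum_add_at (T : finType) (D : {set T}) (p : T) (w f : T -> nat) (e : nat) :
  \sum_(t in D) w t * (f t + (t == p) * e) =
  \sum_(t in D) w t * f t + (p \in D) * (w p * e).
Proof.
under eq_bigr do rewrite mulnDr.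
rewrite big_split /=; congr (_ + _).
have off t : t != p -> w t * ((t == p) * e) = 0 by move/negPf->; rewrite muln0.
have [Dp|Dp] := boolP (p \in D).
  rewrite (big_setD1 p Dp) /= eqxx !mul1n big1 ?addn0 // => t /setD1P[neq_t _].
  exact: off.
by rewrite big1 // => t Dt; apply: off; apply: contraNneq Dp => <-.
Qed.

Lemma sum_add (T : finType) (D : {set T}) (p : T) (f : T -> nat) (e : nat) :
  \sum_(t in D) (f t + (t == p) * e) = \sum_(t in D) f t + (p \in D) * e.
Proof.
have := sum_add_at D p (fun=> 1) f e; rewrite mul1n.
by under eq_bigr do rewrite mul1n; move=> ->; under eq_bigr do rewrite mul1n.
Qed.

(* A map par whose only cycles are fixed points is a rooted forest. M is the set
   of marked nodes and c names the components of D minus M; a component below a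
   marked node is named by its top node. The weight a is what a component may
   carry less than q of, and h counts marked nodes already hanging below, so that
   the last node can be removed by moving its weights to its parent. *)
Lemma mark_nodes (T : finType) (par : T -> T) (rk : T -> nat) (q : nat)
    (D : {set T}) (a h : T -> nat) :
  0 < q ->
  (forall t, par t != t -> rk (par t) < rk t) ->
  {in D, forall t, par t \in D} ->
  exists (M : {set T}) (c : T -> T),
    [/\ M \subset D,
        q * (#|M| + (M != set0)) <= 2 * (\sum_(t in D) a t) + q * \sum_(t in D) h t,
        {in D, forall t, t \notin M ->
           c t \in D /\ c t = if par t \in M then t else c (par t)},
        forall x, \sum_(t in D) ((t \notin M) && (c t == x)) * a t < q &
        forall x, \sum_(t in D) ((t \notin M) && (c t == x)) * h t +
          \sum_(t in D) [&& t \in M, par t \notin M & c (par t) == x] <= 1].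
Proof.
move=> q_gt0 par_lt; have [n] := ubnP #|D|; elim: n D a h => // n IHn D a h.
have [-> _ _|[t1 Dt1]] := set_0Vmem D.
  exists set0, id; split; rewrite ?sub0set ?cards0 ?eqxx ?muln0 //.
  - by move=> t; rewrite inE.
  - by move=> x; rewrite big_set0.
  - by move=> x; rewrite !big_set0.
rewrite ltnS => ltDn parD.
(* A node of largest rank has no other node of [D] below it, so [D'] stays closed under [par]. *)
case: (@arg_maxnP _ t1 [in D] rk Dt1) => t0 /= Dt0 max_t0 {t1 Dt1}.
pose D' := D :\ t0.
have parN t : t \in D' -> (par t == t0) = false.
  case/setD1P=> neq_t Dt; apply/eqP => par_t.
  have := max_t0 _ Dt; have := par_lt t; rewrite par_t eq_sym neq_t /=; lia.
have neq_t t : t \in D' -> (t == t0) = false by case/setD1P=> /negPf.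
have sD'D t : t \in D' -> t \in D by case/setD1P.
have parD' : {in D', forall t, par t \in D'}.
  by move=> t D't; rewrite in_setD1 parN //= parD // sD'D.
have ltD'n : #|D'| < n by rewrite (cardsD1 t0) Dt0 in ltDn.
have par0 : par t0 == t0 \/ par t0 \in D'.
  by rewrite in_setD1 parD // andbT; case: eqP; [left | right].
have [good|bad] := boolP ((a t0 < q) && (h t0 <= 1)).
  (* Unmarked, [t0] hands both weights to its parent and joins its component; as a root or below a
     marked parent it is a component of its own. *)
  have [M [c [sMD' budget cP loadP hangP]]] :=
    IHn D' (fun t => a t + (t == par t0) * a t0) (fun t => h t + (t == par t0) * h t0)
        ltD'n parD'.
  have t0M : t0 \notin M by apply/negP => /(subsetP sMD'); rewrite !inE eqxx.
  pose c0 := if (par t0 == t0) || (par t0 \in M) then t0 else c (par t0).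
  pose c' t := if t == t0 then c0 else c t.
  have massE f x : \sum_(t in D) ((t \notin M) && (c' t == x)) * f t =
      if (par t0 == t0) || (par t0 \in M) then
        if x == t0 then f t0
        else \sum_(t in D') ((t \notin M) && (c t == x)) * f t
      else \sum_(t in D') ((t \notin M) && (c t == x)) *
             (f t + (t == par t0) * f t0).
    rewrite (big_setD1 t0 Dt0) /= t0M {1}/c' eqxx -/D' /=.
    under eq_bigr => t D't do rewrite /c' neq_t //.
    rewrite sum_add_at /c0; case: ifP => [_|/norP[/negPf npar parM]].
      rewrite eq_sym; case: eqP => [->|//].
      rewrite mul1n big1 ?addn0 // => t D't; case: (boolP (t \in M)) => //= tM.
      by case: eqP => // ct; have [] := cP t D't tM; rewrite ct !inE eqxx.
    by case: par0 => [|->]; rewrite ?npar // parM mul1n addnC.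
  have hangE x : \sum_(m in D) [&& m \in M, par m \notin M & c' (par m) == x] =
      \sum_(m in D') [&& m \in M, par m \notin M & c (par m) == x].
    rewrite (big_setD1 t0 Dt0) /= (negPf t0M) add0n.
    by apply: eq_bigr => t D't; rewrite /c' parN.
  have hang0 : \sum_(m in D') [&& m \in M, par m \notin M & c (par m) == t0] = 0.
    apply: big1 => m D'm; have [|parM] := boolP (par m \in M); first by rewrite andbF.
    have [] := cP _ (parD' m D'm) parM; rewrite !inE => /andP[/negPf-> _].
    by rewrite !andbF.
  exists M, c'; split.
  - exact: subset_trans sMD' (subsetDl _ _).
  - apply: leq_trans budget _; rewrite !(big_setD1 t0 Dt0) /= -/D'.
    by rewrite !sum_add; case: (par t0 \in D'); nia.
  - move=> t Dt tM; have [->|neq_t0] := eqVneq t t0; last first.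
      have D't : t \in D' by rewrite !inE neq_t0.
      by rewrite /c' neq_t // parN //; have [/sD'D] := cP t D't tM.
    rewrite /c' eqxx /c0; have [-> /=|neq_par /=] := eqVneq (par t0) t0.
      by rewrite (negPf t0M).
    have [//|parM] := boolP (par t0 \in M).
    case: par0 => [|D'par]; first by rewrite (negPf neq_par).
    by have [/sD'D] := cP _ D'par parM.
  - move=> x; rewrite massE; case: ifP => _; last exact: loadP.
    case: ifP => _; first by case/andP: good.
    by apply: leq_ltn_trans (loadP x); apply: leq_sum => t _; rewrite leq_mul2l leq_addr orbT.
  - move=> x; rewrite massE hangE; have := hangP x; case: ifP => // _.
    case: ifP => [/eqP->|_]; first by rewrite hang0 !addn0; case/andP: good.
    apply: leq_trans; rewrite leq_add2r.
    by apply: leq_sum => t _; rewrite leq_mul2l leq_addr orbT.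
(* Marked, [t0] hands nothing up except one unit of [h]. *)
have [M [c [sMD' budget cP loadP hangP]]] :=
  IHn D' a (fun t => h t + (t == par t0) * 1) ltD'n parD'.
have t0M : t0 \notin M by apply/negP => /(subsetP sMD'); rewrite !inE eqxx.
have inM' t : t \in D' -> (t \in t0 |: M) = (t \in M) by move=> D't; rewrite inE in_set1 neq_t.
exists (t0 |: M), c; split.
- by rewrite subUset sub1set Dt0 (subset_trans sMD') ?subsetDl.
- have -> : t0 |: M != set0 by apply/set0Pn; exists t0; rewrite setU11.
  rewrite cardsU1 t0M !(big_setD1 t0 Dt0) /= -/D'.
  move: budget; rewrite sum_add muln1.
  (* Marking costs [q] for [t0] and at most [q] more, for the unit passed up or for the extra term
     of a first marked node. Either reason for marking, [a t0 >= q] or [h t0 >= 2], pays [2 * q]. *)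
  move: bad; rewrite negb_and -leqNgt -ltnNge.
  have [->|] := eqVneq M set0; first by rewrite cards0; nia.
  by case: (par t0 \in D') => _ /orP[]; nia.
- move=> t Dt; rewrite !inE negb_or => /andP[neq_t0 tM].
  have D't : t \in D' by rewrite !inE neq_t0.
  by rewrite parN //=; have [/sD'D] := cP t D't tM.
- move=> x; rewrite (big_setD1 t0 Dt0) /= setU11 mul0n add0n -/D'.
  by under eq_bigr => t D't do rewrite inM' //.
- move=> x; rewrite !(big_setD1 t0 Dt0) /= setU11 mul0n add0n -/D' /=.
  have := hangP x; rewrite sum_add_at muln1.
  have -> : \sum_(t in D') ((t \notin t0 |: M) && (c t == x)) * h t =
            \sum_(t in D') ((t \notin M) && (c t == x)) * h t.
    by apply: eq_bigr => t D't; rewrite inM'.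
  have -> : \sum_(m in D') [&& m \in t0 |: M, par m \notin t0 |: M & c (par m) == x] =
            \sum_(m in D') [&& m \in M, par m \notin M & c (par m) == x].
    by apply: eq_bigr => m D'm; rewrite !inM' ?parD'.
  rewrite addnA; apply: leq_trans; rewrite leq_add2r leq_add2l.
  case: par0 => [/eqP->|D'par]; first by rewrite setU11.
  by rewrite inM' // D'par mul1n.
Qed.

(** * Separation along a tree-decomposition *)

Lemma card_bigcup_le (I J : finType) (F : I -> {set J}) (N : {set I}) (k : nat) :
  (forall i, #|F i| <= k) -> #|\bigcup_(i in N) F i| <= #|N| * k.
Proof.
move=> F_le; rewrite -sum_nat_const.
elim/big_ind2: _ => [|m U n V leU leV|i _] //; first by rewrite cards0.
by apply: leq_trans (leq_card_setU U V) _; apply: leq_add.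
Qed.

Lemma tree_decomposition_separation (G T : sgraph) (bag : T -> {set G}) (k : nat)
    (A S : {set G}) :
  tree_decomposition bag -> (forall t, #|bag t| <= k) -> S \subset A ->
  exists (X : {set G}) (c : G -> T),
    [/\ S \subset X, X \subset A,
        #|X| <= #|S| \/ #|X| + k < 2 * #|S|,
        {in A :\: X &, forall u v, adj u v -> c u = c v} &
        forall i, #|[set u in X | [exists v in A :\: X, (c v == i) && adj u v]]|
                    <= 4 * k].
Proof.
move=> dec bag_le sSA; have [par [rk [top [par_lt topP bagP]]]] := tree_decomposition_rooted dec.
have [_ edgeP _] := dec.
(* Each vertex of [S] weighs on its top node; the threshold [2k + 1] leaves at most [2k] of them to
   a component. *)
have [|M [c [_ budget cP loadP hangP]]] :=
  @mark_nodes T par rk (2 * k).+1 [set: T] (fun t => #|[set u in S | top u == t]|)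
    (fun=> 0) isT par_lt; first by move=> t _; rewrite inE.
pose B := \bigcup_(m in M) bag m.
have cparE t : t \notin M -> par t \notin M -> c (par t) = c t.
  by move=> tM /negPf parM; have [_] := cP t (in_setT t) tM; rewrite parM.
have ctopE t : t \notin M -> par t \in M -> c t = t.
  by move=> tM parM; have [_] := cP t (in_setT t) tM; rewrite parM.
have sumS : \sum_(t in [set: T]) #|[set u in S | top u == t]| = #|S|.
  rewrite -[RHS]sum1_card (partition_big top xpredT) //=.
  by apply: eq_big => [t|t _]; rewrite ?inE // -sum1dep_card.
(* Induction downwards from [top v] through the nodes holding [v]. *)
have rk_ind (P : T -> Prop) v : P (top v) ->
    (forall t, v \in bag t -> v \in bag (par t) -> P (par t) -> P t) ->
    forall t, v \in bag t -> P t.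
  move=> Ptop Pup t; have [n] := ubnP (rk t); elim: n t => // n IHn t lt_n vt.
  have [->//|neq_t] := eqVneq t (top v).
  have [/par_lt lt_par v_par] := bagP _ _ vt neq_t.
  by apply: Pup => //; apply: IHn => //; lia.
have notB v t : v \notin B -> v \in bag t -> t \notin M.
  by move=> vB vt; apply: contra vB => tM; apply/bigcupP; exists t.
have c_bag v t : v \notin B -> v \in bag t -> c t = c (top v).
  move=> vB; move: t; apply: rk_ind => // t vt v_par <-.
  by rewrite cparE ?(notB v).
exists (S :|: (B :&: A)), (c \o top); split.
- exact: subsetUl.
- by rewrite subUset sSA subsetIr.
- have leX : #|S :|: (B :&: A)| <= #|S| + #|M| * k.
    apply: leq_trans (leq_card_setU _ _) _; rewrite leq_add2l.
    exact: leq_trans (subset_leq_card (subsetIl _ _)) (card_bigcup_le M bag_le).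
  (* With [m] marked nodes, [(2k + 1)(m + 1) <= 2|S|] gives [k(m + 1) < |S|]. *)
  move: budget; rewrite sumS big1 // muln0 addn0.
  have [M0|_ budget] := eqVneq M set0; [left|right].
    by move: leX; rewrite M0 cards0 mul0n addn0.
  nia.
- move=> u v; rewrite !inE => /andP[/norP[_ uBA] uA] /andP[/norP[_ vBA] vA].
  move: uBA vBA; rewrite uA vA !andbT => uB vB /edgeP[t [ut vt]].
  by rewrite /= -(c_bag u t) // -(c_bag v t).
(* The neighbours of component [i] in the separator lie in [L], in the bag of [par i], or in the bag
   of a marked node just below ([H]): at most [2k + k + k]. *)
move=> i; pose H := [set m in M | (par m \notin M) && (c (par m) == i)].
pose L := [set u in S | (top u \notin M) && (c (top u) == i)].
have cardL : #|L| <= 2 * k.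
  rewrite -ltnS; apply: leq_ltn_trans (loadP i).
  rewrite -sum1_card (partition_big top xpredT) //=.
  rewrite [leqRHS](eq_bigl xpredT); last by move=> t; rewrite inE.
  apply: leq_sum => t _; rewrite sum1dep_card.
  have [tMi|tMi] := boolP ((t \notin M) && (c t == i)).
    rewrite mul1n; apply: subset_leq_card; apply/subsetP => u; rewrite !inE.
    by case/andP=> /andP[-> _] ->.
  rewrite mul0n leqn0 cards_eq0; apply/eqP/setP => u; rewrite !inE.
  by apply: contraNF tMi => /andP[/andP[_ tMi] /eqP <-].
have cardH : #|H| <= 1.
  have /= := hangP i; rewrite big1 ?add0n => [|t _]; last by rewrite muln0.
  apply: leq_trans; rewrite -sum1_card big_mkcond /=.
  rewrite [leqRHS](eq_bigl xpredT); last by move=> t; rewrite inE.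
  by apply: leq_sum => m _; rewrite inE; case: ifP.
have sub : [set u in S :|: (B :&: A) | [exists v in A :\: (S :|: (B :&: A)),
              ((c \o top) v == i) && adj u v]]
    \subset L :|: (bag (par i) :|: \bigcup_(m in H) bag m).
  apply/subsetP => u; rewrite inE => /andP[uX /exists_inP[v]].
  rewrite inE => /andP[vX vA] /andP[/eqP/= cv /edgeP[t [ut vt]]].
  have vB : v \notin B by move: vX; rewrite !inE vA andbT => /norP[].
  have tM := notB _ _ vB vt.
  have ct : c t = i by rewrite (c_bag v).
  (* A neighbour is reached from the component either through the marked node
     above it, or at its top node, or through the marked node below it. *)
  have climb : forall t, u \in bag t -> t \notin M -> c t = i ->
      u \in bag (par i) \/ (top u \notin M /\ c (top u) = i).
    apply: rk_ind => [? ?|s us us' IHs sM cs]; first by right.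
    have [parM|parM] := boolP (par s \in M).
      by left; rewrite -cs ctopE.
    by apply: IHs; rewrite ?cparE.
  rewrite !inE; case: (climb t ut tM ct) => [->|[topM ctop]]; first by rewrite orbT.
  have [uS|uS] := boolP (u \in S); first by rewrite topM ctop eqxx.
  have /bigcupP[m mM um] : u \in B by move: uX; rewrite !inE (negPf uS) => /andP[].
  (* On the way down from [top u] to [m], the first node outside component [i] is marked and hangs
     from it, so it is in [H]. *)
  have down : forall t, u \in bag t ->
      (t \notin M /\ c t = i) \/ u \in \bigcup_(m in H) bag m.
    apply: rk_ind => [|s us us' [[parM cpar]|]]; [by left| |by right].
    have [sM|sM] := boolP (s \in M); last by left; rewrite -cparE.
    by right; apply/bigcupP; exists s; rewrite // inE sM parM cpar eqxx.
  case: (down m um) => [[]|->]; last by rewrite !orbT.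
  by rewrite mM.
apply: leq_trans (subset_leq_card sub) _.
apply: leq_trans (leq_card_setU _ _) _.
apply: leq_trans (leq_add cardL (leq_card_setU _ _)) _.
have := leq_trans (card_bigcup_le H bag_le) (leq_mul cardH (leqnn k)).
by move=> /(leq_add (bag_le (par i))) /(leq_add (leqnn (2 * k))); lia.
Qed.

(** * Tree-partitions by recursion *)

Definition linked (L : Type) (p : L -> L) (d : L -> nat) (x y : L) : Prop :=
  [\/ x = y, p x = y /\ d y < d x | p y = x /\ d x < d y].

(* b v is the label of the bag of v; p and d give the parent and the depth of a
   label; S lies in the bag labelled r, which is a root. *)
Definition labelled_partition (G : sgraph) (A S : {set G}) (w : nat)
    (b p : G -> G) (d : G -> nat) (r : G) : Prop :=
  [/\ {in A, forall v, b v \in A},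
      {in A &, forall u v, adj u v -> linked p d (b u) (b v)},
      forall x, #|[set v in A | b v == x]| <= w,
      {in S, forall v, b v = r} &
      d r = 0].

Definition has_labelled_partition (G : sgraph) (A S : {set G}) (w : nat) : Prop :=
  exists b p d r, @labelled_partition G A S w b p d r.

Lemma tpw_le_labelled (G : sgraph) (S : {set G}) (w : nat) :
  has_labelled_partition [set: G] S w -> tpw G <= w.
Proof.
case=> b [p [d [r [_ linkP w_le _ _]]]].
pose C x := [set v | b v == x].
pose P := [set C (b u) | u : G].
have memC v x : (v \in C x) = (b v == x) by rewrite inE.
suff [tpP wP] : tree_partition P /\ partition_width P <= w.
  have [_ minP] := min_natP (ex_tree_partition G).
  by apply: leq_trans wP; apply: minP; exists P.
split; last first.
  apply/bigmax_leqP => B /imsetP[u _ ->]; apply: leq_trans (w_le (b u)).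
  by apply: subset_leq_card; apply/subsetP => v; rewrite !inE.
split=> [v|].
  exists (C (b v)); split; first by rewrite memC eqxx; split=> //; apply/imsetP; exists v.
  by move=> B [/imsetP[u _ ->]]; rewrite memC => /eqP->.
have /choice[lab labP] (B : quotient P) : exists x, val B = C x.
  by have /imsetP[u _ BE] := valP B; exists (b u).
apply: (@forest_of_parent _ _ lab p d) => [B1 B2 eq_lab|B1 B2].
  by apply: val_inj; rewrite !labP eq_lab.
case/andP=> neqB /exists_inP[u]; rewrite labP memC => /eqP uB /exists_inP[v].
rewrite labP memC => /eqP vB uv.
have := linkP u v (in_setT _) (in_setT _) uv; rewrite uB vB.
case=> [eq_lab||]; [|by left|by right].
by case/eqP: neqB; apply: val_inj; rewrite !labP eq_lab.
Qed.

(** [X] becomes the root bag, labelled [x0], and the root of each class becomes its child. Edges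
    leaving [X] end in these roots, since the prescribed set of a class is its neighbourhood of [X].
    As labels stay in their class, [c] tells which partition a label belongs to. *)
Lemma labelled_partition_glue (G : sgraph) (I : eqType) (A S X : {set G})
    (c : G -> I) (w : nat) :
  S \subset X -> X \subset A -> X != set0 -> #|X| <= w ->
  {in A :\: X &, forall u v, adj u v -> c u = c v} ->
  (forall i, has_labelled_partition [set v in A :\: X | c v == i]
     [set v in A :\: X | (c v == i) && [exists u in X, adj u v]] w) ->
  has_labelled_partition A S w.
Proof.
move=> sSX sXA /set0Pn[x0 Xx0] leX cP part.
have /choice[F FP] i : exists F : (G -> G) * (G -> G) * (G -> nat) * G,
    labelled_partition [set v in A :\: X | c v == i]
     [set v in A :\: X | (c v == i) && [exists u in X, adj u v]] w
     F.1.1.1 F.1.1.2 F.1.2 F.2.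
  by have [b [p [d [r ?]]]] := part i; exists (b, p, d, r).
pose b i := (F i).1.1.1; pose p i := (F i).1.1.2.
pose d i := (F i).1.2; pose r i := (F i).2.
pose b' v := if v \in X then x0 else b (c v) v.
pose p' x := if x == r (c x) then x0 else p (c x) x.
pose d' x := if x \in X then 0 else (d (c x) x).+1.
have bP v : v \in A -> v \notin X ->
    [/\ b (c v) v \in A, b (c v) v \notin X & c (b (c v) v) = c v].
  move=> vA vX; have [bC _ _ _ _] := FP (c v).
  by have := bC v; rewrite !inE vX vA eqxx => /(_ isT)/andP[/andP[-> ->] /eqP].
exists b', p', d', x0; split.
- move=> v vA; rewrite /b'; case: ifPn => [_|vX]; first exact: (subsetP sXA).
  by have [] := bP v vA vX.
- have out u v : u \in X -> v \in A -> v \notin X -> adj u v ->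
      p' (b' v) = b' u /\ d' (b' u) < d' (b' v).
    move=> uX vA vX uv; have [bA bX cb] := bP v vA vX.
    rewrite /b' uX (negPf vX) /p' /d' Xx0 (negPf bX) cb.
    have [_ _ _ rS _] := FP (c v).
    rewrite [b _ v]rS ?eqxx // !inE vA vX eqxx /=.
    by apply/exists_inP; exists u.
  move=> u v uA vA uv.
  have [uX|uX] := boolP (u \in X); have [vX|vX] := boolP (v \in X).
  + by rewrite /b' uX vX; constructor 1.
  + by constructor 3; apply: out.
  + by constructor 2; apply: out; rewrite // adj_sym.
  have cuv : c u = c v by apply: cP; rewrite // !inE ?uX ?vX.
  have [bAu bXu cbu] := bP u uA uX; have [bAv bXv cbv] := bP v vA vX.
  have [_ linkC _ _ dr] := FP (c v).
  have up x y : x \notin X -> y \notin X -> c x = c v -> c y = c v ->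
      p (c v) x = y /\ d (c v) y < d (c v) x -> p' x = y /\ d' y < d' x.
    move=> xX yX cx cy [px lt_d]; rewrite /p' /d' (negPf xX) (negPf yX) cx cy.
    (* Redirecting the root is harmless: having depth 0, it has no parent inside its class. *)
    by case: eqP => // xr; rewrite /d xr dr in lt_d.
  have := linkC u v; rewrite !inE uA vA uX vX cuv eqxx => /(_ isT isT uv).
  rewrite cuv in bXu cbu; rewrite /linked /b' (negPf uX) (negPf vX) cuv.
  by case=> [|/up|/up] puv; [constructor 1|constructor 2|constructor 3]; apply: puv.
- move=> x; have [xX|xX] := boolP (x \in X).
    apply: leq_trans leX; apply: subset_leq_card; apply/subsetP => v.
    rewrite inE /b' => /andP[vA]; case: ifPn => // vX /eqP bx.
    by have [_ /negP] := bP v vA vX; rewrite bx.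
  have [_ _ w_le _ _] := FP (c x); apply: leq_trans (w_le x).
  apply: subset_leq_card; apply/subsetP => v; rewrite !inE /b' => /andP[vA].
  case: ifPn => [_ /eqP x0x|vX /eqP bx]; first by rewrite -x0x Xx0 in xX.
  by have [_ _] := bP v vA vX; rewrite bx vA => ->; rewrite eqxx; apply/eqP.
- by move=> v /(subsetP sSX) vX; rewrite /b' vX.
- by rewrite /d' Xx0.
Qed.

Lemma labelled_partition_exists (G T : sgraph) (bag : T -> {set G}) (k w : nat)
    (x0 : G) (A S : {set G}) :
  tree_decomposition bag -> (forall t, #|bag t| <= k) ->
  0 < 4 * k * max_degree G <= w -> 8 * k * max_degree G <= w + k + 1 ->
  S \subset A -> #|S| <= 4 * k * max_degree G -> has_labelled_partition A S w.
Proof.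
move=> dec bag_le /andP[w_gt0 w_ge] w_ge'.
have [n] := ubnP #|A|; elim: n A S => // n IHn A S ltAn sSA leS.
have [A0|/set0Pn[x1 Ax1]] := eqVneq A set0.
  exists id, id, (fun=> 0), x0; split=> // [u v|x|v /(subsetP sSA)]; rewrite A0 ?inE //.
  by rewrite (_ : [set v in set0 | v == x] = set0) ?cards0 //; apply/setP => v; rewrite !inE.
(* A nonempty [S'] makes [X] nonempty, so that the recursion shrinks [A]. *)
have [S' [sSS' sS'A S'0 leS']] : exists S' : {set G},
    [/\ S \subset S', S' \subset A, S' != set0 & #|S'| <= 4 * k * max_degree G].
  have [S0|S0] := eqVneq S set0; last by exists S; split.
  exists [set x1]; rewrite S0 sub0set sub1set Ax1 cards1; split=> //.
  by apply/set0Pn; exists x1; rewrite inE.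
have [X [c [sS'X sXA leX cP nbrP]]] := tree_decomposition_separation dec bag_le sS'A.
have XnE : X != set0 by apply: contraNneq S'0 => X0; rewrite -subset0 -X0.
apply: (@labelled_partition_glue _ _ A S X c) => // [||i].
- exact: subset_trans sS'X.
(* In the second case [|X| + k + 1 <= 2|S'| <= w + k + 1]. *)
- case: leX => [leX|]; last by nia.
  exact: leq_trans leX (leq_trans leS' w_ge).
apply: IHn.
- apply: leq_trans (_ : #|A| <= n) => //.
  apply: proper_card; apply/properP; split.
    by apply/subsetP => v; rewrite !inE => /andP[/andP[_ ->]].
  have /set0Pn[x Xx] := XnE; exists x; first exact: (subsetP sXA).
  by rewrite !inE Xx.
- by apply/subsetP => v; rewrite !inE => /andP[-> /andP[-> _]].
pose N j := [set u in X | [exists v in A :\: X, (c v == j) && adj u v]].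
have deg_le (u : G) : #|[set v | adj u v]| <= max_degree G.
  exact: (@leq_bigmax _ (@degree G) u).
apply: leq_trans (leq_trans (card_bigcup_le (N i) deg_le) _); last first.
  by rewrite leq_mul2r nbrP orbT.
apply: subset_leq_card; apply/subsetP => v; rewrite inE => /and3P[vAX ci].
case/exists_inP=> u uX uv; apply/bigcupP; exists u; last by rewrite inE.
by rewrite inE uX /=; apply/exists_inP; exists v; rewrite ?ci.
Qed.

(** * Maximum degree one and the final bound *)

Lemma tpw_degree1 (G : sgraph) (x0 : G) : max_degree G <= 1 -> tpw G <= 1.
Proof.
move=> deg1; apply: (@tpw_le_labelled G set0).
(* The parent is the partner in the matching; depths need only differ along edges. The value 0 is
   kept for [x0], which serves as the root [r]. *)
exists id, (fun v => odflt v [pick w | adj v w]),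
  (fun v => if v == x0 then 0 else (enum_rank v).+1), x0.
split=> // [u v _ _ uv|x|v|]; last 2 first; rewrite ?inE ?eqxx //; last first.
  rewrite (_ : [set v in _ | _] = [set x]) ?cards1 //.
  by apply/setP => v; rewrite !inE.
have nbr (u1 v1 : G) : adj u1 v1 -> odflt u1 [pick w | adj u1 w] = v1.
  move=> uv1; case: pickP => [w uw /=|/(_ v1)]; last by rewrite uv1.
  have deg_u : degree u1 <= 1 by exact: leq_trans (@leq_bigmax _ (@degree G) u1) deg1.
  by apply: (card_le1_eqP deg_u); rewrite inE.
have neq_uv : u != v by apply: contraTneq uv => ->; rewrite adj_irr.
have neq_rk : enum_rank u != enum_rank v :> nat.
  by rewrite (inj_eq val_inj) (inj_eq enum_rank_inj).
rewrite /linked (nbr u v) // (nbr v u) 1?adj_sym //.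
case: (eqVneq u x0) neq_uv => [->|_]; first by rewrite eq_sym => /negPf->; constructor 3.
case: (eqVneq v x0) => [_|_] _; first by constructor 2.
rewrite !ltnS; move: neq_rk; rewrite neq_ltn => /orP[lt_uv|lt_vu].
  by constructor 3.
by constructor 2.
Qed.

Theorem theorem1 (G : sgraph) (tw_ge1 : (1 <= tw G)%N)
    (max_degree_ge1 : (1 <= max_degree G)%N) :
  ((tpw G)%:R < 5%:R / 2%:R * ((tw G)%:R + 1)
                * (7%:R / 2%:R * (max_degree G)%:R - 1) :> rat)%R.
Proof.
have [x0 _] : exists x : G, true.
  case: (pickP (fun _ : G => true)) => [x|G0]; first by exists x.
  by rewrite /max_degree big_pred0 // in max_degree_ge1.
have [deg1|deg_gt1] := leqP (max_degree G) 1.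
  have -> : max_degree G = 1 by apply/eqP; rewrite eqn_leq deg1.
  have := tpw_degree1 x0 deg1; rewrite -(ler_nat rat) => tpw1.
  have : (0 <= (tw G)%:R :> rat)%R by apply: ler0n.
  by lra.
have [[T [bag [dec width]]] _] := min_natP (ex_tree_decomposition G).
have bag_le t : #|bag t| <= (tw G).+1.
  apply: leq_trans (@leq_bigmax _ (fun t => #|bag t|) t) _.
  by rewrite /tw -width /decomposition_width leqSpred.
pose w := 8 * (tw G).+1 * max_degree G - (tw G).+1 - 1.
have w_ge : w + (tw G).+1 + 1 = 8 * (tw G).+1 * max_degree G by rewrite /w; nia.
have tpw_le : tpw G <= w.
  apply: (@tpw_le_labelled G set0).
  apply: (labelled_partition_exists x0 dec bag_le); rewrite ?sub0set ?cards0 //.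
    by apply/andP; split; nia.
  by rewrite w_ge.
have : ((tpw G)%:R + ((tw G)%:R + 1) + 1 <= 8%:R * ((tw G)%:R + 1) * (max_degree G)%:R :> rat)%R.
  by rewrite natr1 -natrD natr1 -!natrM ler_nat; lia.
(* With [k = tw G + 1] and [D = max_degree G], the claimed bound exceeds [8kD - k - 1] by
   [3k(D - 2)/4 + 1], so [D >= 2] suffices. *)
have : (2%:R * ((tw G)%:R + 1) <= ((tw G)%:R + 1) * (max_degree G)%:R :> rat)%R.
  by rewrite natr1 -!natrM ler_nat mulnC leq_mul2l deg_gt1.
by lra.
Qed.
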